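(* Let $\lambda_1<\dots<\lambda_N$ and $c_{ij}=\frac1{N(\lambda_i-\lambda_j)^2}$ for $i\ne j$. Consider the operators on functions of $n$-particle configurations $$\mathscr B^{(s)}f(\boldsymbol\eta)=\sum_{i\ne j}c_{ij}\,2\eta_i(1+2\eta_j)\left(f(\boldsymbol\eta^{i,j})-f(\boldsymbol\eta)\right),\qquad \mathscr B^{(h)}f(\boldsymbol\eta)=\sum_{i\ne j}c_{ij}\,\eta_i(1+\eta_j)\left(f(\boldsymbol\eta^{i,j})-f(\boldsymbol\eta)\right).$$ (i) Define a measure on configurations by $$\pi^{(s)}(\boldsymbol\eta)=\prod_{x=1}^N\phi(\eta_x),\qquad\phi(k)=\prod_{i=1}^k\Big(1-\frac1{2i}\Big).$$ Then $\pi^{(s)}$ is a reversible measure for $\mathscr B^{(s)}$, and the Dirichlet form is $$D^{\pi^{(s)}}(f)=\sum_{\boldsymbol\eta}\pi^{(s)}(\boldsymbol\eta)\sum_{i\ne j}c_{ij}\,\eta_i(1+2\eta_j)\left(f(\boldsymbol\eta^{i,j})-f(\boldsymbol\eta)\right)^2.$$ (ii) The uniform measure $\pi^{(h)}(\boldsymbol\eta)=1$ for all $\boldsymbol\eta$ is reversible with respect to $\mathscr B^{(h)}$, and the Dirichlet form is $$D^{\pi^{(h)}}(f)=\frac12\sum_{\boldsymbol\eta}\sum_{i\ne j}c_{ij}\,\eta_i(1+\eta_j)\left(f(\boldsymbol\eta^{i,j})-f(\boldsymbol\eta)\right)^2.$$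
   Context: A configuration is a map $\boldsymbol\eta:\llbracket1,N\rrbracket\to\mathbb{N}=\{0,1,2,\dots\}$, $\eta_j=\boldsymbol\eta(j)$ being the number of particles at site $j$; the number of particles $n=\sum_j\eta_j$ is fixed, and sums over $\boldsymbol\eta$ run over the (finite) set of $n$-particle configurations. $\boldsymbol\eta^{i,j}$ is the configuration obtained by moving one particle from $i$ to $j$; if there is no particle at $i$, $\boldsymbol\eta^{i,j}=\boldsymbol\eta$. Sums over $i\neq j$ run over ordered pairs in $\llbracket 1,N\rrbracket$. A measure $\pi$ is reversible with respect to a generator $L$ if $\sum_{\boldsymbol\eta}\pi(\boldsymbol\eta)g(\boldsymbol\eta)Lf(\boldsymbol\eta)=\sum_{\boldsymbol\eta}\pi(\boldsymbol\eta)f(\boldsymbol\eta)Lg(\boldsymbol\eta)$ for all functions $f,g$; the Dirichlet form is then $D^\pi(f)=-\sum_{\boldsymbol\eta}\pi(\boldsymbol\eta)f(\boldsymbol\eta)Lf(\boldsymbol\eta)$. *)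

(* Defs.v *)
From HB Require Import structures.
From mathcomp Require Import all_boot all_order all_algebra.
Set Implicit Arguments.
Unset Strict Implicit.
Unset Printing Implicit Defensive.
Import Order.TTheory GRing.Theory Num.Theory.
Local Open Scope ring_scope.

(* [n]-particle configurations on [N] sites; site [j] of the mathematical
   numbering 1, ..., N is the ordinal of value [j - 1]. *)
Record config (N n : nat) := Config {
  occ :> {ffun 'I_N -> nat};
  _ : (\sum_(x < N) occ x == n)%N
}.

HB.instance Definition _ (N n : nat) := [isSub for @occ N n].
HB.instance Definition _ (N n : nat) := [Countable of config N n by <:].

Section ConfigFinite.
Variables N n : nat.

Lemma config_sum (eta : config N n) : (\sum_(x < N) eta x = n)%N.
Proof. by case: eta => e /= /eqP. Qed.

Lemma config_le (eta : config N n) (x : 'I_N) : (eta x <= n)%N.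
Proof.
have := config_sum eta; rewrite (bigD1 x) //= => {2}<-.
exact: leq_addr.
Qed.

Definition config_code (eta : config N n) : {ffun 'I_N -> 'I_n.+1} :=
  [ffun x => inord (eta x)].

Definition config_decode (u : {ffun 'I_N -> 'I_n.+1}) : option (config N n) :=
  insub [ffun x => u x : nat].

Lemma config_codeK : pcancel config_code config_decode.
Proof.
move=> eta; rewrite /config_decode.
suff -> : [ffun x => config_code eta x : nat] = val eta by rewrite valK.
by apply/ffunP=> x; rewrite !ffunE inordK // ltnS config_le.
Qed.

End ConfigFinite.

HB.instance Definition _ (N n : nat) : isFinite (config N n) :=
  PCanIsFinite (@config_codeK N n).

Definition move_occ (N : nat) (e : {ffun 'I_N -> nat}) (i j : 'I_N) :
    {ffun 'I_N -> nat} :=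
  if e i == 0%N then e else [ffun x => (e x - (x == i) + (x == j))%N].

Lemma move_occ_sum (N n : nat) (eta : config N n) (i j : 'I_N) :
  (\sum_(x < N) move_occ eta i j x == n)%N.
Proof.
apply/eqP; rewrite /move_occ; case: eqP => [_|/eqP ei]; first exact: config_sum.
transitivity (\sum_(x < N) eta x)%N; last exact: config_sum.
have delta (k : 'I_N) : (\sum_(x < N) (x == k) = 1)%N.
  by rewrite (bigD1 k) //= eqxx big1 // => x /negPf->.
under eq_bigr => x _ do rewrite ffunE.
rewrite big_split /= delta -(delta i) -big_split /=.
apply: eq_bigr => x _; rewrite subnK //.
by case: eqP => // ->; rewrite lt0n.
Qed.

(* The configuration eta^{i,j}. *)
Definition move (N n : nat) (eta : config N n) (i j : 'I_N) : config N n :=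
  Config (move_occ_sum eta i j).

Section Reversibility.
Variables (R : realFieldType) (T : finType).

Definition reversible (pi : T -> R) (L : (T -> R) -> T -> R) : Prop :=
  (forall eta, 0 <= pi eta) /\
  forall f g : T -> R,
    \sum_eta pi eta * g eta * L f eta = \sum_eta pi eta * f eta * L g eta.

Definition dirichlet (pi : T -> R) (L : (T -> R) -> T -> R) (f : T -> R) : R :=
  - \sum_eta pi eta * f eta * L f eta.

End Reversibility.

Section Generators.
Variables (R : realFieldType) (N n : nat) (lambda : 'I_N -> R).

(* Only used for i != j. *)
Definition rate (i j : 'I_N) : R := 1 / (N%:R * (lambda i - lambda j) ^+ 2).

Definition gen_s (f : config N n -> R) (eta : config N n) : R :=
  \sum_(i < N) \sum_(j < N | i != j)
    rate i j * (2 * (eta i)%:R * (1 + 2 * (eta j)%:R))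
      * (f (move eta i j) - f eta).

Definition gen_h (f : config N n -> R) (eta : config N n) : R :=
  \sum_(i < N) \sum_(j < N | i != j)
    rate i j * ((eta i)%:R * (1 + (eta j)%:R)) * (f (move eta i j) - f eta).

End Generators.

Definition phi (R : realFieldType) (k : nat) : R :=
  \prod_(1 <= i < k.+1) (1 - 1 / (2 * i%:R)).

Definition pi_s (R : realFieldType) (N n : nat) (eta : config N n) : R :=
  \prod_(x < N) phi R (eta x).

Definition pi_h (R : realFieldType) (N n : nat) (eta : config N n) : R := 1.

(* Main.v *)
(* A generator with rates [w] in detailed balance with [pi] is governed by the
   edge sums [edge_sum w pi F] of [F eta eta^{i,j}], weighted by the flow
   [pi eta * w eta i j]. Detailed balance and the bijection
   [eta |-> eta^{i,j}] between configurations with a particle at [i] and those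
   with a particle at [j] show that edge sums do not change when the arguments
   of [F] are exchanged. Reversibility follows by applying this to
   [g eta * f eta'], and the Dirichlet form by averaging [- f eta * (f eta' - f
   eta)] with its exchange, which gives half the square of the difference. *)
Require Import Defs.
From mathcomp Require Import all_boot all_order all_algebra.
From mathcomp Require Import ring.
Set Implicit Arguments.
Unset Strict Implicit.
Unset Printing Implicit Defensive.
Import Order.TTheory GRing.Theory Num.Theory.
Local Open Scope ring_scope.

Section Moves.
Context {N n : nat}.
Implicit Types (eta : config N n) (i j x : 'I_N).

Lemma moveE eta i j x : eta i != 0%N ->
  move eta i j x = (eta x - (x == i) + (x == j))%N.
Proof. by move=> /negPf ei; rewrite /= /move_occ ei ffunE. Qed.

Lemma move_tgt_neq0 eta i j : eta i != 0%N -> move eta i j j != 0%N.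
Proof. by move=> ei; rewrite moveE // eqxx addn1. Qed.

Lemma move_srcE eta i j : eta i != 0%N -> i != j -> (move eta i j i).+1 = eta i.
Proof.
move=> ei /negPf ij; rewrite moveE // eqxx ij addn0 subn1 prednK //.
by rewrite lt0n.
Qed.

Lemma move_tgtE eta i j : eta i != 0%N -> i != j -> move eta i j j = (eta j).+1.
Proof. by move=> ei ij; rewrite moveE // eqxx eq_sym (negPf ij) subn0 addn1. Qed.

(** The first move leaves a particle at [j], so the second is a genuine move. The truncated
    subtraction at [i] is undone because [eta i] is positive. *)
Lemma moveK eta i j : eta i != 0%N -> move (move eta i j) j i = eta.
Proof.
move=> ei; apply/val_inj/ffunP => x.
rewrite [LHS]moveE ?move_tgt_neq0 // moveE // addnK subnK //.
by case: eqP => // ->; rewrite lt0n.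
Qed.

End Moves.

Section DetailedBalance.
Context {R : realFieldType} {N n : nat}.
Variables (w : config N n -> 'I_N -> 'I_N -> R) (pi : config N n -> R).
Implicit Types (eta xi : config N n) (f g : config N n -> R).
Implicit Types F G : config N n -> config N n -> R.

Definition edge_sum F : R :=
  \sum_(eta : config N n) pi eta *
    \sum_(i < N) \sum_(j < N | i != j) w eta i j * F eta (move eta i j).

(** Shaped so that [gen_s] and [gen_h] are instances up to conversion. *)
Definition jump_gen f (eta : config N n) : R :=
  \sum_(i < N) \sum_(j < N | i != j) w eta i j * (f (move eta i j) - f eta).

Lemma eq_edge_sum F G : (forall eta xi, F eta xi = G eta xi) ->
  edge_sum F = edge_sum G.
Proof.
move=> eqFG; apply: eq_bigr => eta _; congr (_ * _).
by apply: eq_bigr => i _; apply: eq_bigr => j _; rewrite eqFG.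
Qed.

Lemma edge_sumD F G :
  edge_sum (fun eta xi => F eta xi + G eta xi) = edge_sum F + edge_sum G.
Proof.
rewrite /edge_sum -big_split; apply: eq_bigr => eta _ /=.
rewrite -mulrDr -big_split; congr (_ * _); apply: eq_bigr => i _ /=.
by rewrite -big_split; apply: eq_bigr => j _; rewrite mulrDr.
Qed.

Lemma edge_sumN F : edge_sum (fun eta xi => - F eta xi) = - edge_sum F.
Proof.
rewrite /edge_sum -sumrN; apply: eq_bigr => eta _.
rewrite -mulrN -sumrN; congr (_ * _); apply: eq_bigr => i _.
by rewrite -sumrN; apply: eq_bigr => j _; rewrite mulrN.
Qed.

Lemma sum_mul_jump_gen f g :
  \sum_eta pi eta * g eta * jump_gen f eta =
  edge_sum (fun eta xi => g eta * (f xi - f eta)).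
Proof.
apply: eq_bigr => eta _; rewrite -mulrA; congr (_ * _).
rewrite mulr_sumr; apply: eq_bigr => i _; rewrite mulr_sumr.
by apply: eq_bigr => j _; rewrite mulrCA.
Qed.

Hypothesis w_empty : forall eta (i j : 'I_N), eta i = 0%N -> w eta i j = 0.
Hypothesis balance : forall eta (i j : 'I_N), i != j -> eta i != 0%N ->
  pi eta * w eta i j = pi (move eta i j) * w (move eta i j) j i.

(** Terms with an empty source vanish by [w_empty]. What remains, for each ordered pair of sites, is
    a sum over the configurations on which the move is invertible. *)
Lemma edge_sumE F : edge_sum F =
  \sum_(i < N) \sum_(j < N | i != j) \sum_(eta : config N n | eta i != 0%N)
    pi eta * w eta i j * F eta (move eta i j).
Proof.
rewrite /edge_sum; under eq_bigr do rewrite mulr_sumr.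
rewrite exchange_big; apply: eq_bigr => i _.
under eq_bigr do rewrite mulr_sumr.
rewrite exchange_big; apply: eq_bigr => j _.
rewrite [RHS]big_mkcond; apply: eq_bigr => eta _; rewrite mulrA.
by case: eqP => // ei; rewrite w_empty // mulr0 mul0r.
Qed.

Lemma edge_sumC F : edge_sum F = edge_sum (fun eta xi => F xi eta).
Proof.
(* Swapping the two site sums on the right pairs the moves from [i] to [j] with those from [j] to
   [i]. *)
rewrite [RHS]edge_sumE (exchange_big_dep xpredT) //= edge_sumE.
apply: eq_bigr => i _; apply: eq_big => [j|j ij]; first by rewrite eq_sym.
rewrite [RHS](reindex_onto (fun eta => move eta i j) (fun xi => move xi j i)).
  apply: eq_big => [eta | eta ei]; last by rewrite moveK // -balance.
  apply/idP/andP => [ei | [mj /eqP mK]].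
    by rewrite moveK // move_tgt_neq0.
  (* Here [eta] results from a genuine move into [i], so it has a particle there. *)
  by rewrite -mK move_tgt_neq0.
by move=> xi xj; rewrite moveK.
Qed.

Lemma jump_gen_reversible : (forall eta, 0 <= pi eta) -> reversible pi jump_gen.
Proof.
move=> pi_ge0; split=> // f g.
rewrite !sum_mul_jump_gen.
under eq_edge_sum => eta xi do rewrite mulrBr.
under [RHS]eq_edge_sum => eta xi do rewrite mulrBr.
(* The cross term [g eta * f xi] needs the exchange; the term [g eta * f eta] is symmetric in [f]
   and [g] pointwise. *)
rewrite !edge_sumD; congr (_ + _).
  by rewrite edge_sumC; apply: eq_edge_sum => eta xi; rewrite mulrC.
by apply: eq_edge_sum => eta xi; rewrite mulrC.
Qed.

Lemma jump_gen_dirichlet f :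
  dirichlet pi jump_gen f = 1 / 2 * edge_sum (fun eta xi => (f xi - f eta) ^+ 2).
Proof.
pose F eta xi := - (f eta * (f xi - f eta)).
have -> : dirichlet pi jump_gen f = edge_sum F.
  by rewrite /dirichlet sum_mul_jump_gen -edge_sumN.
have -> : edge_sum (fun eta xi => (f xi - f eta) ^+ 2) = edge_sum F + edge_sum F.
  rewrite [X in _ + X]edge_sumC -edge_sumD.
  by apply: eq_edge_sum => eta xi; rewrite /F; ring.
by field.
Qed.

End DetailedBalance.

Lemma rateC (R : realFieldType) (N : nat) (lambda : 'I_N -> R) (i j : 'I_N) :
  rate lambda i j = rate lambda j i.
Proof. by rewrite /rate -opprB sqrrN. Qed.

(** One-site detailed balance: the last factor of [phi R k.+1] is [(2 * k + 1) / (2 * (k + 1))]. *)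
Lemma phiS (R : realFieldType) (k : nat) :
  phi R k.+1 * (2 * k.+1%:R) = phi R k * (1 + 2 * k%:R).
Proof.
rewrite /phi big_nat_recr //= -!mulrA; congr (_ * _).
have k1 : k.+1%:R != 0 :> R by rewrite pnatr_eq0.
by rewrite -natr1 in k1 *; field.
Qed.

(** The product starts at index 1, so every factor is at least 1/2. *)
Lemma phi_ge0 (R : realFieldType) (k : nat) : 0 <= phi R k.
Proof.
rewrite /phi big_nat_cond; apply: prodr_ge0 => i /andP[/andP[i_gt0 _] _].
have i2 : 1 <= 2 * i%:R :> R by rewrite -natrM ler1n muln_gt0.
by rewrite subr_ge0 ler_pdivrMr ?mul1r // (lt_le_trans ltr01).
Qed.

Section Balance.
Context {R : realFieldType} {N n : nat}.
Variable lambda : 'I_N -> R.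

Lemma pi_s_balance (eta : config N n) (i j : 'I_N) :
  i != j -> eta i != 0%N ->
  let xi := move eta i j in
  pi_s R eta * (rate lambda i j * (2 * (eta i)%:R * (1 + 2 * (eta j)%:R))) =
  pi_s R xi * (rate lambda j i * (2 * (xi j)%:R * (1 + 2 * (xi i)%:R))).
Proof.
move=> ij ei xi.
have piE (zeta : config N n) : pi_s R zeta = phi R (zeta i) * (phi R (zeta j) *
    \prod_(x < N | (x != i) && (x != j)) phi R (zeta x)).
  by rewrite /pi_s (bigD1 i) //= (bigD1 j) // eq_sym.
rewrite !piE.
(* Both sides are now written with the smaller occupations [xi i] and [eta j] and their
   successors. *)
rewrite (rateC lambda j i) -(move_srcE ei ij) (move_tgtE ei ij) -/xi.
have -> : \prod_(x < N | (x != i) && (x != j)) phi R (xi x) =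
          \prod_(x < N | (x != i) && (x != j)) phi R (eta x).
  apply: eq_bigr => x /andP[/negPf xi' /negPf xj].
  by rewrite moveE // xi' xj subn0 addn0.
set P := \prod_(x < N | _) _; set r := rate _ _ _.
(* Grouping the factors by site lets [phiS] act forwards at [i] and backwards at [j]. *)
transitivity (P * r * (phi R (xi i).+1 * (2 * (xi i).+1%:R))
  * (phi R (eta j) * (1 + 2 * (eta j)%:R))); first by ring.
by rewrite phiS -(phiS R (eta j)); ring.
Qed.

(** Both sides equal the rate times [(xi i + 1) * (eta j + 1)]. *)
Lemma pi_h_balance (eta : config N n) (i j : 'I_N) :
  i != j -> eta i != 0%N ->
  let xi := move eta i j in
  pi_h R eta * (rate lambda i j * ((eta i)%:R * (1 + (eta j)%:R))) =
  pi_h R xi * (rate lambda j i * ((xi j)%:R * (1 + (xi i)%:R))).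
Proof.
move=> ij ei xi.
rewrite (rateC lambda j i) -(move_srcE ei ij) (move_tgtE ei ij) -/xi.
by rewrite /pi_h !nat1r; congr (_ * (_ * _)); rewrite mulrC.
Qed.

End Balance.

Theorem proposition3p2 (R : realFieldType) (N n : nat) (lambda : 'I_N -> R)
    (lambda_incr : forall i j : 'I_N, (i < j)%N -> lambda i < lambda j) :
  (reversible (@pi_s R N n) (@gen_s R N n lambda) /\
   forall f : config N n -> R,
     dirichlet (@pi_s R N n) (@gen_s R N n lambda) f =
     \sum_(eta : config N n) pi_s R eta *
       \sum_(i < N) \sum_(j < N | i != j)
         rate lambda i j * ((eta i)%:R * (1 + 2 * (eta j)%:R))
           * (f (move eta i j) - f eta) ^+ 2) /\
  (reversible (@pi_h R N n) (@gen_h R N n lambda) /\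
   forall f : config N n -> R,
     dirichlet (@pi_h R N n) (@gen_h R N n lambda) f =
     1 / 2 * \sum_(eta : config N n)
       \sum_(i < N) \sum_(j < N | i != j)
         rate lambda i j * ((eta i)%:R * (1 + (eta j)%:R))
           * (f (move eta i j) - f eta) ^+ 2).
Proof.
pose ws (eta : config N n) (i j : 'I_N) : R :=
  rate lambda i j * (2 * (eta i)%:R * (1 + 2 * (eta j)%:R)).
pose wh (eta : config N n) (i j : 'I_N) : R :=
  rate lambda i j * ((eta i)%:R * (1 + (eta j)%:R)).
have ws0 (eta : config N n) i j : eta i = 0%N -> ws eta i j = 0.
  by rewrite /ws => ->; rewrite mulr0 mul0r mulr0.
have wh0 (eta : config N n) i j : eta i = 0%N -> wh eta i j = 0.
  by rewrite /wh => ->; rewrite mul0r mulr0.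
have bs := pi_s_balance (n := n) lambda.
have bh := pi_h_balance (n := n) lambda.
split; split.
- apply: (jump_gen_reversible (w := ws)) => // eta.
  by apply: prodr_ge0 => x _; apply: phi_ge0.
(* The factor 1/2 cancels the 2 in [ws], which is why this Dirichlet form carries no 1/2. *)
- move=> f; rewrite [LHS](jump_gen_dirichlet (w := ws)) // mulr_sumr.
  apply: eq_bigr => eta _; rewrite mulrCA; congr (_ * _).
  rewrite mulr_sumr; apply: eq_bigr => i _; rewrite mulr_sumr.
  by apply: eq_bigr => j _; rewrite /ws; field.
- by apply: (jump_gen_reversible (w := wh)) => // eta; apply: ler01.
- move=> f; rewrite [LHS](jump_gen_dirichlet (w := wh)) //; congr (_ * _).
  by apply: eq_bigr => eta _; rewrite mul1r.
Qed.
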